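(* Let $L$ be a finite graded lattice and let $\mathbf m=\{\hat0=m_0<m_1<\dots<m_r=\hat1\}$ be a chain of left-modular elements of $L$, and suppose exactly $s$ of the intervals $[m_{i-1},m_i]$ ($1\le i\le r$) are nontrivial. Then $L$ has a quasi-$EL$-labeling assigning to each maximal chain exactly $r$ distinct labels and exactly $s$ repeated labels. In particular, the $(r+s-2)$-skeleton of the order complex $\vert L\vert$ is vertex-decomposable.
   Context: An interval $[m_{i-1},m_i]$ is nontrivial if it has length at least $2$, i.e. $m_{i-1}$ is not covered by $m_i$. A pair $(x,y)$ is a modular pair if $(y\vee x)\wedge z=y\vee(x\wedge z)$ for all $z\ge y$; $x$ is left-modular if $(x,y)$ is a modular pair for all $y$. $\vert L\vert$ is the simplicial complex of chains in $L\setminus\{\hat0,\hat1\}$; the $k$-skeleton consists of faces of dimension at most $k$. An edge labeling assigns to each cover relation a label in a totally ordered set; a maximal chain's label sequence is read bottom to top, chains are compared lexicographically, and a label is repeated on a chain if it occurs at least twice. A quasi-$EL$-labeling is an edge labeling such that for every interval $[x,y]$ there is a chain $\mathbf a=\{x=a_0<\dots<a_k=y\}$ with (i) every weakly ascending (weakly increasing labels) maximal chain of $[x,y]$ contains $\mathbf a$; (ii) for each $i$ all cover relations in $[a_{i-1},a_i]$ receive a common label; (iii) maximal chains of $[x,y]$ containing $\mathbf a$ are strictly lexicographically earlier than all other maximal chains of $[x,y]$. A complex is vertex-decomposable if it is a simplex or has a vertex $v$ such that for each face $\sigma\ni v$ there is a vertex $w\notin\sigma$ with $(\sigma\setminus v)\cup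 w$ a face, and both the deletion of $v$ and $\operatorname{link}v$ are vertex-decomposable. *)

(* Defs.v *)
From HB Require Import structures.
From mathcomp Require Import all_boot all_order all_algebra.
Set Implicit Arguments.
Unset Strict Implicit.
Unset Printing Implicit Defensive.
Import Order.Theory.

Local Open Scope order_scope.

Section Poset.
Variables (d : Order.disp_t) (P : finPOrderType d).

Definition covers (x y : P) : bool :=
  (x < y) && [forall z : P, ~~ (x < z < y)].

(* A maximal chain x = c_0 < c_1 < ... < c_k = y of the interval [x, y] is
   given by the sequence c = [:: c_1; ...; c_k]; the bottom x is kept apart. *)
Definition maximal_chain (x y : P) (c : seq P) : Prop :=
  path covers x c /\ last x c = y.

(* Only the values of an edge labeling on cover relations are relevant. *)
Definition label_seq (T : Type) (lam : P -> P -> T) (x : P) (c : seq P) :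
  seq T := pairmap lam x c.

Definition quasi_EL_labeling (d' : Order.disp_t) (Lam : orderType d')
    (lam : P -> P -> Lam) : Prop :=
  forall x y : P, x <= y ->
  exists a : seq P,
  [/\ path <%O x a /\ last x a = y,
      forall c : seq P, maximal_chain x y c ->
        sorted <=%O (label_seq lam x c) -> {subset x :: a <= x :: c},
      forall i : nat, (i < size a)%N ->
        exists l : Lam, forall u v : P,
          nth x (x :: a) i <= u -> covers u v -> v <= nth x (x :: a) i.+1 ->
          lam u v = l
    & forall c c' : seq P, maximal_chain x y c -> maximal_chain x y c' ->
        {subset x :: a <= x :: c} -> ~ {subset x :: a <= x :: c'} ->
        (label_seq lam x c : seqlexi Lam) < (label_seq lam x c' : seqlexi Lam)].

End Poset.

Definition num_distinct (T : eqType) (w : seq T) : nat := size (undup w).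

Definition num_repeated (T : eqType) (w : seq T) : nat :=
  size [seq l <- undup w | (2 <= count_mem l w)%N].

Section Lattice.
Variables (d : Order.disp_t) (L : finTBLatticeType d).

Definition graded : Prop :=
  forall c c' : seq L,
    maximal_chain \bot \top c -> maximal_chain \bot \top c' ->
    size c = size c'.

Definition modular_pair (x y : L) : Prop :=
  forall z : L, y <= z -> (y `|` x) `&` z = y `|` (x `&` z).

Definition left_modular (x : L) : Prop := forall y : L, modular_pair x y.

Definition order_complex : {set {set L}} :=
  [set sigma : {set L} |
    [&& \bot \notin sigma, \top \notin sigma
      & [forall x in sigma, forall y in sigma, x >=< y]]].

End Lattice.
Arguments graded {d} L.
Arguments order_complex {d} L.

(* A simplicial complex is given by its set of faces, the empty face, of
   dimension -1, included. *)
Section Complex.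
Variable T : finType.
Implicit Types (D : {set {set T}}) (v w : T) (sigma : {set T}).

Definition skeleton (k : int) D : {set {set T}} :=
  [set sigma in D | (#|sigma|%:Z - 1 <= k)%R].

Definition deletion v D : {set {set T}} := [set sigma in D | v \notin sigma].

Definition link v D : {set {set T}} :=
  [set sigma : {set T} | (v \notin sigma) && (v |: sigma \in D)].

(* The void complex (no face at all) is regarded as the simplex of dimension
   -2. It is never a link or a deletion of a vertex; it only occurs as the
   (-2)-skeleton, for the one-element lattice. *)
Definition is_simplex D : Prop :=
  D = set0 \/ exists V : {set T}, D = powerset V.

Definition shedding_exchange v D : Prop :=
  forall sigma, sigma \in D -> v \in sigma ->
  exists w, [/\ [set w] \in D, w \notin sigma & w |: (sigma :\ v) \in D].

Inductive vertex_decomposable : {set {set T}} -> Prop :=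
| VD_simplex D : is_simplex D -> vertex_decomposable D
| VD_shedding D v :
    [set v] \in D -> shedding_exchange v D ->
    vertex_decomposable (deletion v D) -> vertex_decomposable (link v D) ->
    vertex_decomposable D.

End Complex.

(* Main.v *)
(* For a left-modular [m], rk (m /\ x) + rk (m \/ x) = rk m + rk x.  Hence on a
   cover x < y the number rk (m_i /\ y) - rk (m_i /\ x) is 0 or 1, and it is
   nondecreasing in i; label the cover by the index l where it jumps, the least
   l with y <= x \/ m_(l+1).  The number of edges labeled l on a maximal chain
   of [x, y] then depends only on x and y, so all label sequences of [x, y] are
   rearrangements of each other.  The sorted one, which is lexicographically
   first, is carried exactly by the chains through all the elements
   x \/ (m_i /\ y).

   For the skeleton, let f(x, t) be the sum over l of min(2, n_l), with n_l the
   number of labels l in [x, t].  The chains of size < f(x, t) of the open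
   interval (x, t) are shown to be vertex-decomposable by induction on the
   length.  Let i be least with m_(i+1) /\ t not below x, and
   mu = x \/ (m_(i+1) /\ t).  First shed, from the top down, the z with
   m_(i+1) /\ z <= x, then, again from the top down, the elements incomparable
   to mu.  Every link is a join of smaller instances, and what is left is the
   join of (x, mu), mu and (mu, t). *)
Require Import Defs.
From mathcomp Require Import all_boot all_order all_algebra.
From mathcomp Require Import zify.

Set Implicit Arguments.
Unset Strict Implicit.
Unset Printing Implicit Defensive.
Import Order.Theory.

Local Open Scope order_scope.

(** * Vertex-decomposability of skeleta of complexes of chains *)

Section ChainSkeleta.
Variables (d : Order.disp_t) (P : finPOrderType d).
Implicit Types (X Y A : {set P}) (v w x y z : P) (k p q : nat).

Definition is_chain A := [forall x in A, forall y in A, x >=< y].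

Lemma is_chainP A : reflect {in A &, forall x y, x >=< y} (is_chain A).
Proof.
apply: (iffP forall_inP) => [H x y xA yA|H x xA].
  exact: (forall_inP (H x xA)).
by apply/forall_inP => y yA; apply: H.
Qed.

(** Bounding the size by [k] gives the skeleton of dimension [k - 1] and keeps the index a natural
    number; for [k = 0] only the empty face is left. *)
Definition chain_complex k X : {set {set P}} :=
  [set A : {set P} | [&& A \subset X, is_chain A & (#|A| <= k)%N]].

(** The vertices of the link of [v], as [link_chain_complex] shows. *)
Definition comparables v X := [set w in X | (w != v) && (w >=< v)].

(* The complex of chains of size at most [k] in [X] is pure of dimension
   [k - 1] and is vertex-decomposable through complexes of the same kind. *)
Inductive chain_vd : nat -> {set P} -> Prop :=
| chain_vd0 X : chain_vd 0 X
| chain_vd_simplex X : is_chain X -> chain_vd #|X| X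
| chain_vd_shed k X v : v \in X -> chain_vd k.+1 (X :\ v) ->
    chain_vd k (comparables v X) -> chain_vd k.+1 X.

Lemma is_chainS A X : A \subset X -> is_chain X -> is_chain A.
Proof.
move=> /subsetP AX /is_chainP cX; apply/is_chainP => x y xA yA.
by apply: cX; apply: AX.
Qed.

Lemma is_chainU1 v A : is_chain A -> {in A, forall w, w >=< v} ->
  is_chain (v |: A).
Proof.
move=> /is_chainP cA cv; apply/is_chainP => x y /setU1P[->|xA] /setU1P[->|yA].
- exact: comparablexx.
- by rewrite comparable_sym cv.
- exact: cv.
- exact: cA.
Qed.

(** A chain avoiding the shed vertex [v] already extends in the deletion. If [v] lies in [A], then
    [A :\ v] extends in the link, and [v] can be put back. *)
Lemma chain_vd_pure k X A : chain_vd k X -> A \subset X -> is_chain A ->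
  (#|A| < k)%N -> exists2 w, w \in X :\: A & is_chain (w |: A).
Proof.
move=> H; elim: H A => {k X} [//|X cX A AX cA sA|k X v vX _ IH1 _ IH2 A AX cA sA].
  have /set0Pn[w wXA] : X :\: A != set0.
    by rewrite -card_gt0 cardsD (setIidPr AX) subn_gt0.
  exists w => //; apply: is_chainS cX; rewrite subUset AX sub1set.
  by case/setDP: wXA => ->.
have [vA|vA] := boolP (v \in A); last first.
  have [|//|//|w] := IH1 A.
    by rewrite subsetD1 AX.
  rewrite !inE => /and3P[wA _ wX] cw.
  by exists w => //; rewrite !inE wA.
have /is_chainP cA' := cA.
have [| | |w] := IH2 (A :\ v).
- apply/subsetP => w /setD1P[wv wA]; rewrite !inE wv (subsetP AX) //=.
  exact: cA'.
- by apply: is_chainS cA; apply: subsetDl.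
- by move: sA; rewrite (cardsD1 v) vA add1n ltnS.
rewrite !inE negb_and negbK => /andP[wA /and3P[wX wv cwv]] cw.
have wA' : w \notin A by case/orP: wA => [/eqP wv'|//]; rewrite wv' eqxx in wv.
exists w; first by rewrite !inE wA'.
rewrite -(setD1K vA) setUCA; apply: is_chainU1 => // u.
by case/setU1P => [->//|/setD1P[_ uA]]; apply: cA'.
Qed.

Lemma deletion_chain_complex k X v :
  deletion v (chain_complex k X) = chain_complex k (X :\ v).
Proof.
by apply/setP => A; rewrite !inE subsetD1; case: (v \in A);
  rewrite ?andbF ?andbT.
Qed.

Lemma link_chain_complex k X v : v \in X ->
  link v (chain_complex k.+1 X) = chain_complex k (comparables v X).
Proof.
move=> vX; apply/setP => A; rewrite !inE.
have [vA|vA] /= := boolP (v \in A).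
  symmetry; apply/negbTE/negP => /and3P[/subsetP/(_ _ vA)].
  by rewrite !inE eqxx andbF.
rewrite cardsU1 vA add1n ltnS subUset sub1set vX /=.
case: leqP; rewrite ?andbF ?andbT // => _.
apply/andP/andP => [[AX cA]|[/subsetP AX cA]].
  split; last by apply: is_chainS cA; apply: subsetUr.
  apply/subsetP => w wA; rewrite !inE (subsetP AX) //=.
  rewrite (is_chainP _ cA) ?setU11 ?setU1r // andbT.
  by apply: contraNneq vA => <-.
split; first by apply/subsetP => w /AX; rewrite inE => /andP[].
by apply: is_chainU1 => // w /AX; rewrite !inE => /and3P[].
Qed.

(** The exchange for a face [A] containing [v] comes from purity of the deletion: [A :\ v] is too
    small to be a facet there, so it extends by some [w] other than [v]. *)
Lemma chain_vd_vertex_decomposable k X :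
  chain_vd k X -> vertex_decomposable (chain_complex k X).
Proof.
elim=> {k X} [X|X cX|k X v vX H1 IH1 H2 IH2].
- apply: VD_simplex; right; exists set0; apply/setP => A.
  rewrite !inE leqn0 cards_eq0 subset0;
    apply/idP/eqP => [/and3P[_ _ /eqP]//|->].
  by rewrite sub0set eqxx andbT; apply/is_chainP => x y; rewrite inE.
- apply: VD_simplex; right; exists X; apply/setP => A; rewrite !inE.
  have [AX|//] /= := boolP (A \subset X).
  by rewrite (subset_leq_card AX) (is_chainS AX).
- have sub1 w : w \in X -> [set w] \in chain_complex k.+1 X.
    move=> wX; rewrite inE sub1set wX cards1 andbT /=.
    by apply/is_chainP => x y /set1P-> /set1P->; apply: comparablexx.
  apply: (@VD_shedding _ _ v); first exact: sub1.
  + move=> A; rewrite inE => /and3P[AX cA sA] vA.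
    have sA' : (#|A :\ v| < k.+1)%N by move: sA; rewrite (cardsD1 v) vA add1n.
    have [||w] := chain_vd_pure H1 _ _ sA'.
    * exact: setSD.
    * by apply: is_chainS cA; apply: subsetDl.
    rewrite !inE negb_and negbK => /andP[wA /andP[wv wX]] cw.
    have wA' : w \notin A by case/orP: wA => [/eqP wv'|//];
      rewrite wv' eqxx in wv.
    exists w; split => //; first exact: sub1.
    rewrite inE cw subUset sub1set wX (subset_trans (subsetDl _ _) AX) /=.
    by rewrite cardsU1 !inE (negPf wA') andbF add1n.
  + by rewrite deletion_chain_complex.
  + by rewrite link_chain_complex.
Qed.

Lemma comparables_sub v X : comparables v X \subset X :\ v.
Proof. by apply/subsetP => w; rewrite !inE => /and3P[-> ->]. Qed.

Lemma chain_vdW k X : chain_vd k.+1 X -> chain_vd k X.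
Proof.
suff H j Y : chain_vd j Y -> chain_vd j.-1 Y by move/H.
elim=> {j Y} [Y|Y cY|[|j] Y v vY _ IH1 _ IH2] //=; try exact: chain_vd0;
  last first.
  exact: chain_vd_shed vY IH1 IH2.
(* A simplex drops to its boundary: after shedding [v], the deletion is the full simplex on [Y :\ v]
   and the link is the boundary of that simplex. *)
move En : #|Y| => n; elim: n Y cY En => [|[|n] IH] Y cY En /=;
  try exact: chain_vd0.
have /set0Pn[v vY] : Y != set0 by rewrite -card_gt0 En.
have En1 : #|Y :\ v| = n.+1 by move: En; rewrite (cardsD1 v) vY => -[].
have cY1 : is_chain (Y :\ v) by apply: is_chainS cY; apply: subsetDl.
apply: (chain_vd_shed vY); first by rewrite -En1; apply: chain_vd_simplex.
suff -> : comparables v Y = Y :\ v by apply: IH.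
apply/eqP; rewrite eqEsubset comparables_sub; apply/subsetP => w.
by rewrite !inE => /andP[-> wY]; rewrite wY (is_chainP _ cY).
Qed.

Lemma chain_vd_leq j k X : (j <= k)%N -> chain_vd k X -> chain_vd j X.
Proof.
by elim: k => [|k IH]; rewrite leq_eqVlt => /orP[/eqP->//|//];
  rewrite ltnS => jk /chain_vdW /(IH jk).
Qed.

(** * Joins and cones *)

Lemma comparablesU v X Y :
  comparables v (X :|: Y) = comparables v X :|: comparables v Y.
Proof. by apply/setP => w; rewrite !inE andb_orl. Qed.

Lemma comparables_id v X : v \notin X -> {in X, forall w, w >=< v} ->
  comparables v X = X.
Proof.
move=> vX cv; apply/eqP; rewrite eqEsubset; apply/andP; split.
  by apply/subsetP => w; rewrite inE => /andP[].
by apply/subsetP => w wX; rewrite inE wX cv // andbT /=;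
  apply: contraNneq vX => <-.
Qed.

(** Under this condition the chains of [X :|: Y] form the simplicial join of the two chain
    complexes. *)
Definition joined X Y :=
  [disjoint X & Y] /\ (forall x y, x \in X -> y \in Y -> x >=< y).

Lemma joinedS X X' Y Y' : X' \subset X -> Y' \subset Y -> joined X Y ->
  joined X' Y'.
Proof.
move=> /subsetP sX /subsetP sY [dXY cXY]; split; last first.
  by move=> x y /sX xX /sY yY; apply: cXY.
by apply: disjointWl (introT subsetP sX) (disjointWr (introT subsetP sY) dXY).
Qed.

Lemma setUD1l v X Y : v \notin Y -> (X :|: Y) :\ v = (X :\ v) :|: Y.
Proof.
move=> vY; rewrite setDUl; congr (_ :|: _); apply/setP => w; rewrite !inE.
by case: eqVneq => // ->; rewrite (negPf vY).
Qed.

Lemma joined_notin X Y v : joined X Y -> v \in X -> v \notin Y.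
Proof. by case=> dXY _ vX; move: (disjointFr dXY vX) => ->. Qed.

Lemma joined_comparables X Y v : joined X Y -> v \in X ->
  comparables v (X :|: Y) = comparables v X :|: Y.
Proof.
move=> jXY vX; rewrite comparablesU (@comparables_id v Y) //.
  exact: joined_notin jXY vX.
by move=> w wY; rewrite comparable_sym; apply: jXY.2.
Qed.

(** The elements of [X] are shed one at a time until only [Y] is left. A link has the same form with
    a smaller [X] and a bound lowered by one, supplied by [chain_vdW]. *)
Lemma chain_vd_joinW q X Y : joined X Y -> chain_vd q Y -> chain_vd q (X :|: Y).
Proof.
move En : #|X| => n; elim/ltn_ind: n q X En => n IH [|q] X En jXY H.
  exact: chain_vd0.
have [->|/set0Pn[v vX]] := eqVneq X set0; first by rewrite set0U.
have sXv : (#|X :\ v| < n)%N by rewrite -En [in ltnRHS](cardsD1 v) vX.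
apply: (@chain_vd_shed _ _ v); first by rewrite inE vX.
  rewrite setUD1l ?(joined_notin jXY) //; apply: (IH _ sXv) => //.
  exact: joinedS (subsetDl _ _) (subxx _) jXY.
rewrite joined_comparables //.
have sc : (#|comparables v X| < n)%N.
  exact: leq_ltn_trans (subset_leq_card (comparables_sub _ _)) sXv.
apply: (IH _ sc) => //; last exact: chain_vdW.
apply: joinedS (subxx _) jXY.
exact: subset_trans (comparables_sub _ _) (subsetDl _ _).
Qed.

(** The shedding of [X] is copied: [v] stays a cone point of every deletion and link. *)
Lemma chain_vd_cone k v X : v \notin X -> {in X, forall w, w >=< v} ->
  chain_vd k X -> chain_vd k.+1 (v |: X).
Proof.
move=> vX cX H; elim: H vX cX => {k X} [X|X cX|k X u uX _ IH1 _ IH2] vX cv.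
- rewrite setUC; apply: chain_vd_joinW.
    split; first by rewrite disjoint_sym disjoints1.
    by move=> x y xX /set1P->; apply: cv.
  rewrite -(cards1 v); apply: chain_vd_simplex.
  by apply/is_chainP => x y /set1P-> /set1P->; apply: comparablexx.
- have -> : #|X|.+1 = #|v |: X| by rewrite cardsU1 vX.
  by apply: chain_vd_simplex; apply: is_chainU1.
- have vu : v != u by apply: contraNneq vX => ->.
  apply: (@chain_vd_shed _ _ u); first by rewrite !inE uX orbT.
    rewrite setUC setUD1l; last by rewrite inE eq_sym.
    rewrite setUC; apply: IH1; first by rewrite !inE (negPf vX) andbF.
    by move=> w /setD1P[_]; apply: cv.
  rewrite comparablesU (@comparables_id u [set v]); first last.
  + by move=> w /set1P->; rewrite comparable_sym cv.
  + by rewrite inE eq_sym.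
  apply: IH2; first by rewrite !inE (negPf vX).
  by move=> w; rewrite inE => /andP[/cv].
Qed.

(** Vertices shed in [X] are shed in the union as well, and the elements of a simplex are added to
    [Y] as cone points. *)
Lemma chain_vd_join p q X Y : joined X Y -> chain_vd p X -> chain_vd q Y ->
  chain_vd (p + q) (X :|: Y).
Proof.
move=> jXY HX HY; elim: HX jXY => {p X} [X|X cX|p X v vX _ IH1 _ IH2] jXY.
- exact: chain_vd_joinW.
- move En : #|X| => n; elim: n X cX jXY En => [|n IH] X cX jXY En.
    by move/eqP: En; rewrite cards_eq0 => /eqP->; rewrite set0U.
  have /set0Pn[v vX] : X != set0 by rewrite -card_gt0 En.
  rewrite -(setD1K vX) -setUA addSn; apply: chain_vd_cone.
  + by rewrite !inE eqxx (joined_notin jXY).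
  + move=> w /setUP[/setD1P[_ wX]|wY]; first exact: (is_chainP _ cX).
    by rewrite comparable_sym; apply: jXY.2.
  + apply: IH; first by apply: is_chainS cX; apply: subsetDl.
      exact: joinedS (subsetDl _ _) (subxx _) jXY.
    by move: En; rewrite (cardsD1 v) vX => -[].
- rewrite addSn; apply: (@chain_vd_shed _ _ v); first by rewrite inE vX.
    rewrite setUD1l ?(joined_notin jXY) //; apply: IH1.
    exact: joinedS (subsetDl _ _) (subxx _) jXY.
  rewrite joined_comparables //; apply: IH2.
  apply: joinedS (subxx _) jXY.
  exact: subset_trans (comparables_sub _ _) (subsetDl _ _).
Qed.

Lemma chain_vd1 X : X != set0 -> chain_vd 1 X.
Proof.
case/set0Pn=> v vX; move En : #|X| => n; elim: n X vX En => [|n IH] X vX En.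
  by move/eqP: En; rewrite cards_eq0 => /eqP X0; rewrite X0 inE in vX.
have [X0|/set0Pn[w wX]] := eqVneq (X :\ v) set0.
  have -> : X = [set v] by rewrite -(setD1K vX) X0 setU0.
  rewrite -(cards1 v); apply: chain_vd_simplex.
  by apply/is_chainP => x y /set1P-> /set1P->; apply: comparablexx.
have /setD1P[wv wX'] := wX.
apply: (chain_vd_shed wX'); last exact: chain_vd0.
apply: IH; first by rewrite !inE eq_sym wv.
by move: En; rewrite (cardsD1 w) wX' => -[].
Qed.

(* The elements of [X] outside [Y] are shed from the top down, so that only
   elements of [Y] are left above the element being shed. *)
Lemma chain_vd_topdown k X Y : Y \subset X -> chain_vd k.+1 Y ->
  (forall z, z \in X -> z \notin Y ->
     chain_vd k ([set w in X | w < z] :|: [set w in Y | z < w])) ->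
  chain_vd k.+1 X.
Proof.
move=> sYX HY; move En : #|X| => n; elim: n X sYX En => [|n IH] X sYX En HX.
  move/eqP: En; rewrite cards_eq0 => /eqP X0; move: sYX.
  by rewrite X0 subset0 => /eqP <-.
have [XY|/set0Pn[z0 z0X]] := eqVneq (X :\: Y) set0.
  have -> // : X = Y.
  by apply/eqP; rewrite eqEsubset sYX andbT -setD_eq0 XY.
(* Having the most elements below it makes [z] maximal in [X :\: Y]. *)
case: (@arg_maxnP _ z0 [pred z | z \in X :\: Y]
   (fun z => #|[set w | w < z]|) z0X) => z /= zX zmax.
have {}zmax w : w \in X -> z < w -> w \in Y.
  move=> wX zw; apply/negPn/negP => wY.
  have /zmax : w \in X :\: Y by rewrite inE wX wY.
  apply/negP; rewrite -ltnNge; apply: proper_card; apply/properP; split.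
    by apply/subsetP => u; rewrite !inE => /lt_trans; apply.
  by exists z; rewrite !inE ?ltxx.
case/setDP: zX => zX zY.
apply: (chain_vd_shed zX).
  apply: IH; first by rewrite subsetD1 sYX.
    by move: En; rewrite (cardsD1 z) zX => -[].
  move=> u /setD1P[uz uX] uY.
  (* All elements above [z] lie in [Y], so [z] is not below [u], and removing it changes nothing
     there. *)
  suff -> : [set w in X :\ z | w < u] = [set w in X | w < u] by apply: HX.
  apply/setP => w; rewrite !inE; case: eqVneq => //= ->.
  by rewrite zX; apply/esym/negbTE/negP => /(zmax _ uX); apply/negP.
suff -> : comparables z X = [set w in X | w < z] :|: [set w in Y | z < w].
  exact: HX.
apply/setP => w; rewrite !inE /Order.comparable !lt_def (eq_sym z w).
have [->|wz] /= := eqVneq w z; first by rewrite !andbF.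
have [wX|wX] /= := boolP (w \in X).
  have [wz'|nwz] //= := boolP (w <= z).
  have [zw|nzw] := boolP (z <= w); last by rewrite andbF.
  by rewrite (zmax w) // lt_def wz.
by symmetry; apply: contraNF wX => /andP[/(subsetP sYX)].
Qed.

End ChainSkeleta.

(** * Maximal chains in a finite poset *)

Section MaximalChains.
Variables (d : Order.disp_t) (P : finPOrderType d).
Implicit Types (x y : P) (c : seq P).

Lemma exists_cover x y : x < y -> exists2 v, covers x v & v <= y.
Proof.
move=> xy.
have Py : [pred v | x < v <= y] y by rewrite /= xy lexx.
case: (@arg_minnP _ y [pred v | x < v <= y] (fun v => #|[set w | w < v]|) Py).
move=> v /= /andP[xv vy] vmin; exists v => //; rewrite /covers xv /=.
apply/forallP => z; apply/negP => /andP[xz zv].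
have /vmin : x < z <= y by rewrite xz (le_trans (ltW zv) vy).
apply/negP; rewrite -ltnNge; apply: proper_card; apply/properP; split.
  by apply/subsetP => u; rewrite !inE => /lt_trans; apply.
by exists z; rewrite !inE ?ltxx.
Qed.

Lemma exists_maximal_chain x y : x <= y ->
  exists c, path (@covers _ _) x c && (last x c == y).
Proof.
move En : #|[set w | x < w]| => n; elim/ltn_ind: n x En => n IH x En.
rewrite le_eqVlt => /orP[/eqP->|xy]; first by exists [::]; rewrite /= eqxx.
have [v xv vy] := exists_cover xy.
have lt_xv : x < v by case/andP: xv.
have [|c /andP[pc lc]] := IH _ _ v erefl vy.
  rewrite -En; apply: proper_card; apply/properP; split.
    by apply/subsetP => u; rewrite !inE; apply: lt_trans.
  by exists v; rewrite !inE ?ltxx.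
by exists (v :: c); rewrite /= xv pc.
Qed.

Lemma path_covers_le x c : path (@covers _ _) x c -> x <= last x c.
Proof.
elim: c x => //= v c IH x /andP[/andP[/ltW xv _] /IH]; exact: le_trans.
Qed.

Lemma path_covers_ge x c z : path (@covers _ _) x c -> z \in x :: c -> x <= z.
Proof.
elim: c x => [|v c IH] x /=; first by rewrite inE => _ /eqP->.
case/andP=> /andP[/ltW xv _] pc; rewrite inE => /orP[/eqP->//|/(IH _ pc)].
exact: le_trans.
Qed.

Lemma path_covers_mem_le x c z : path (@covers _ _) x c -> z \in x :: c ->
  z <= last x c.
Proof.
elim: c x => [|v c IH] x /=; first by rewrite inE => _ /eqP->.
case/andP=> /andP[/ltW xv _] pc; rewrite inE => /orP[/eqP->|/(IH _ pc)//].
exact: le_trans (path_covers_le pc).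
Qed.

(** Meant for the sequence of cuts, which may repeat. Every step of [a] is a step of [s], so what
    holds between consecutive cuts carries over. *)
Lemma strict_subchain x (s : seq P) : path <=%O x s ->
  exists a : seq P, [/\ path <%O x a, last x a = last x s,
    x :: a =i x :: s &
    forall i, (i < size a)%N -> exists2 j, (j < size s)%N &
      nth x (x :: a) i = nth x (x :: s) j /\
      nth x (x :: a) i.+1 = nth x (x :: s) j.+1].
Proof.
(* The default [z] of [nth] stays fixed while the head [x] varies in the induction. *)
suff H z : path <=%O x s -> exists a : seq P, [/\ path <%O x a,
    last x a = last x s, x :: a =i x :: s &
    forall i, (i < size a)%N -> exists2 j, (j < size s)%N &
      nth z (x :: a) i = nth z (x :: s) j /\
      nth z (x :: a) i.+1 = nth z (x :: s) j.+1] by apply: H.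
elim: s x => [|y s IH] x /=; first by exists [::].
case/andP=> xy /IH[a [pa la ma na]].
move: xy; rewrite le_eqVlt => /orP[/eqP xy|xy].
  exists a; rewrite xy; split => //.
    by move=> w; rewrite ma !inE orbA orbb.
  by move=> i /na[j js]; exists j.+1.
exists (y :: a); split => //=; first by rewrite xy.
  by move=> w; rewrite in_cons ma -in_cons.
move=> [|i] /=; first by exists 0%N.
by rewrite ltnS => /na[j js]; exists j.+1.
Qed.

End MaximalChains.

(** The head of the sorted word is the minimum of the common multiset. Either it is smaller than the
    head of [w'], or equal heads cancel. *)
Lemma sorted_seqlexi_lt (w w' : seq nat) : perm_eq w w' -> sorted <=%O w ->
  ~~ sorted <=%O w' -> (w : seqlexi nat) < (w' : seqlexi nat).
Proof.
elim: w w' => [|a w IH] [|b w'] //.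
move=> pw sw sw'; rewrite ltxi_cons.
have aw : all (<=%O a) w by move: sw;
  rewrite /= (path_sortedE le_trans) => /andP[].
have aw' z : z \in b :: w' -> a <= z.
  by rewrite -(perm_mem pw) inE => /orP[/eqP->|/(allP aw)].
have ab : a <= b by apply: aw'; rewrite mem_head.
rewrite ab /=; apply/implyP => ba.
have Eab : a = b by apply: le_anti; rewrite ab.
rewrite -Eab perm_cons in pw.
apply: IH pw (path_sorted sw) _; apply: contra sw' => sw'.
rewrite /= (path_sortedE le_trans) sw' andbT; apply/allP => z zw'.
by rewrite -Eab; apply: aw'; rewrite inE zw' orbT.
Qed.

(** * Rank function and left-modular elements *)

Section Ranks.
Variables (d : Order.disp_t) (L : finTBLatticeType d).

(** The rank is the length of a chosen maximal chain from the bottom. For a cover, both chosen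
    chains are completed by the same chain from [y] to the top, and gradedness compares the
    totals. *)
Lemma graded_rank : graded L ->
  exists rk : L -> nat, forall x y, covers x y -> rk y = (rk x).+1.
Proof.
move=> gL; have ex (x : L) := exists_maximal_chain (le0x x).
exists (fun x : L => size (xchoose (ex x))) => x y xy.
have /andP[p1 /eqP l1] := xchooseP (ex x);
  have /andP[p2 /eqP l2] := xchooseP (ex y).
set c1 := xchoose (ex x) in p1 l1 *; set c2 := xchoose (ex y) in p2 l2 *.
have [c /andP[p3 /eqP l3]] := exists_maximal_chain (lex1 y).
have := gL (c1 ++ y :: c) (c2 ++ c); rewrite /maximal_chain.
rewrite !cat_path !last_cat p1 p2 l1 l2 /= xy p3 l3 !size_cat /= => /(_ _ _).
by rewrite addnS -addSn => /(_ (conj isT erefl) (conj isT erefl)) /addIn.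
Qed.

Variable rk : L -> nat.
Hypothesis rk_covers : forall x y, covers x y -> rk y = (rk x).+1.
Implicit Types (x y z u v w : L) (i j l : nat).

Lemma rk_last x c : path (@covers _ _) x c -> rk (last x c) = (rk x + size c)%N.
Proof.
elim: c x => [|v c IH] x /=; first by rewrite addn0.
by case/andP=> /rk_covers xv /IH->; rewrite xv addSnnS.
Qed.

Lemma rk_le x y : x <= y -> (rk x <= rk y)%N.
Proof.
by case/exists_maximal_chain => c /andP[/rk_last+ /eqP lc]; rewrite lc => ->;
  apply: leq_addr.
Qed.

Lemma rk_lt x y : x < y -> (rk x < rk y)%N.
Proof. by case/exists_cover => v /rk_covers xv /rk_le; rewrite xv. Qed.

Lemma rk_eq x y : x <= y -> rk x = rk y -> x = y.
Proof. by rewrite le_eqVlt => /orP[/eqP//|/rk_lt]; lia. Qed.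

(** Each cover on a maximal chain from [a] to [b] is sent to a strict inequality, so the rank of the
    image grows by at least one. *)
Lemma rk_strict_homo (phi : L -> L) a b : a <= b ->
  (forall u v, a <= u -> u < v -> v <= b -> phi u < phi v) ->
  (rk (phi a) + rk b <= rk (phi b) + rk a)%N.
Proof.
case/exists_maximal_chain => c /andP[pc /eqP lc].
elim: c a pc lc => [|v c IH] a /=; first by move=> _ -> _; lia.
case/andP=> av pc lc H.
have lt_av : a < v by case/andP: av.
have vb : v <= b by rewrite -lc; apply: path_covers_le.
have h1 := rk_lt (H a v (lexx _) lt_av vb).
suff : (rk (phi v) + rk b <= rk (phi b) + rk v)%N by have := rk_covers av; lia.
by apply: IH => // u w vu; apply: H; apply: le_trans vu; apply: ltW.
Qed.

(* Left modularity makes [z |-> z \/ m] injective on [m /\ x, x] and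
   [z |-> z /\ m] injective on [x, m \/ x]. *)
Lemma left_modular_rk (m x : L) : left_modular m ->
  (rk (m `&` x) + rk (m `|` x) = rk m + rk x)%N.
Proof.
move=> mm; apply/eqP; rewrite eqn_leq; apply/andP; split.
  have h1 : x <= m `|` x by rewrite leUr.
  have := @rk_strict_homo (fun z => m `&` z) _ _ h1.
  rewrite joinKI => h2;
    suff : (rk (m `&` x) + rk (m `|` x) <= rk m + rk x)%N by [].
  apply: h2 => u v xu uv vm; rewrite lt_def leI2 ?(ltW uv) // andbT.
  have E z : x <= z -> z <= m `|` x -> z = x `|` (m `&` z).
    by move=> xz zm; rewrite -mm // joinC meetC; apply/esym/meet_idPl.
  apply: contraTneq (uv) => Euv.
  have Eu := E u xu (le_trans (ltW uv) vm).
  have Ev := E v (le_trans xu (ltW uv)) vm.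
  by rewrite Eu -Euv -Ev ltxx.
have h1 : m `&` x <= x by rewrite leIr.
have := @rk_strict_homo (fun z => z `|` m) _ _ h1.
rewrite joinC meetKU (joinC x) => h2.
suff : (rk m + rk x <= rk (m `|` x) + rk (m `&` x))%N by lia.
apply: h2 => u v mu uv vx; rewrite lt_def leU2 ?(ltW uv) // andbT.
have E z : m `&` x <= z -> z <= x -> z = (z `|` m) `&` x.
  by move=> mz zx; rewrite mm // join_l.
apply: contraTneq (uv) => Euv.
have Eu := E u mu (le_trans (ltW uv) vx).
have Ev := E v (le_trans mu (ltW uv)) vx.
by rewrite Eu -Euv -Ev ltxx.
Qed.

End Ranks.

(** * The labeling given by a chain of left-modular elements *)

Section ModularChain.
Variables (d : Order.disp_t) (L : finTBLatticeType d) (rk : L -> nat).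
Hypothesis rk_covers : forall x y : L, covers x y -> rk y = (rk x).+1.
Variables (r : nat) (M : nat -> L).
Hypotheses (M0 : M 0 = \bot) (Mr : M r = \top).
Hypothesis M_homo : {homo M : i j / (i <= j)%N >-> i <= j}.
Hypothesis M_mod : forall i, left_modular (M i).
Implicit Types (x y z t u v w : L) (i j l : nat) (c : seq L).

Lemma label_ex x y : exists i, y <= x `|` M i.+1.
Proof.
exists r; apply: (le_trans (lex1 y)); rewrite -Mr.
by apply: (le_trans (M_homo (leqnSn r))); rewrite leUr.
Qed.

(** Label [i] belongs to the step from [M i] to [M i.+1], so covers carry labels from [0] to
    [r - 1]. *)
Definition label x y : nat := ex_minn (label_ex x y).

Lemma label_lt x y i : x < y -> (y <= x `|` M i) = (label x y < i)%N.
Proof.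
move=> xy; rewrite /label; case: ex_minnP => l Hl lmin; apply/idP/idP;
  last first.
  by move=> li; apply: (le_trans Hl); rewrite leU2 // M_homo.
case: i => [|i] Hi; last exact: lmin.
by move: Hi; rewrite M0 joinx0 (lt_geF xy).
Qed.

Definition mrk i x : nat := rk (M i `&` x).
(** By [mrk_step_last], the number of labels [i] on any maximal chain from the bottom to [x]. *)
Definition mrk_step i x : nat := (mrk i.+1 x - mrk i x)%N.

Lemma mrk_modular i x : (mrk i x + rk (M i `|` x) = rk (M i) + rk x)%N.
Proof. exact: left_modular_rk. Qed.

(** If [y] is below the join of [x] and [M i], then [x] and [y] have the same join with [M i], and
    [mrk_modular] moves the rank jump to the meets. Otherwise that join meets [y] in [x], so the
    meets with [M i] agree. *)
Lemma mrk_covers i x y : covers x y -> mrk i y = (mrk i x + (label x y < i))%N.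
Proof.
move=> cxy; have lxy : x < y by case/andP: cxy.
rewrite -label_lt //; have [yx|yx] := boolP (y <= x `|` M i).
  have := mrk_modular i x; have := mrk_modular i y; rewrite (rk_covers cxy).
  suff -> : M i `|` y = M i `|` x by lia.
  apply: le_anti; rewrite [X in _ && X]leU2 ?(ltW lxy) // andbT leUx leUl /=.
  by rewrite joinC.
rewrite addn0 /mrk; congr rk; apply: le_anti.
rewrite [X in _ && X]leI2 ?(ltW lxy) // andbT lexI leIl /=.
have xz : x <= (x `|` M i) `&` y by rewrite lexI leUl ltW.
have zy : (x `|` M i) `&` y < y.
  rewrite lt_def leIr andbT; apply: contra yx => /eqP E.
  by rewrite E leIl.
have -> : x = (x `|` M i) `&` y.
  apply/eqP; case/andP: cxy => _ /forallP/(_ ((x `|` M i) `&` y)).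
  by rewrite zy andbT lt_def xz andbT negbK eq_sym.
by rewrite lexI leIr andbT (le_trans (leIl _ _)) // leUr.
Qed.

Lemma mrk_last i x c : path (@covers _ _) x c ->
  mrk i (last x c) = (mrk i x + count (fun l => l < i)%N (label_seq label x c))%N.
Proof.
elim: c x => [|v c IH] x /=; first by rewrite addn0.
by case/andP=> /mrk_covers xv /IH ->; rewrite (xv i) addnA.
Qed.

Lemma mrk_homo i j x y : (i <= j)%N -> x <= y -> (mrk i x <= mrk j y)%N.
Proof. by move=> ij xy; apply: rk_le rk_covers _ _ _; rewrite leI2 // M_homo.
  Qed.

Lemma mrk_step_last i x c : path (@covers _ _) x c ->
  mrk_step i (last x c) = (mrk_step i x + count_mem i (label_seq label x c))%N.
Proof.
move=> pc; rewrite /mrk_step !(mrk_last _ pc).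
have -> : count (fun l => (l < i.+1)%N) (label_seq label x c) =
   (count (fun l => (l < i)%N) (label_seq label x c) +
    count_mem i (label_seq label x c))%N.
  by elim: (label_seq _ _ _) => //= a s ->; lia.
have := mrk_homo (leqnSn i) (lexx x); lia.
Qed.

Lemma label_seq_perm x c c' :
  path (@covers _ _) x c -> path (@covers _ _) x c' -> last x c = last x c' ->
  perm_eq (label_seq label x c) (label_seq label x c').
Proof.
move=> pc pc' lc; apply/allP => i _; apply/eqP => /=.
have := mrk_step_last i pc; have := mrk_step_last i pc'; rewrite lc.
by move=> -> /addnI ->.
Qed.

(** In a sorted chain the labels below [i] come first; [z] is the element reached just after
    them. *)
Lemma sorted_label_cut i x c : path (@covers _ _) x c ->
  sorted <=%O (label_seq label x c) ->
  exists2 z, z \in x :: c & M i `&` last x c <= z /\ z <= x `|` M i.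
Proof.
elim: c x => [|v c IH] x /=.
  by exists x; rewrite ?mem_head // leIr leUl.
case/andP=> xv pc; rewrite (path_sortedE le_trans) => /andP[al sl].
have lxv : x < v by case/andP: xv.
have [li|il] := ltnP (label x v) i.
  have [z zc [z1 z2]] := IH v pc sl.
  exists z; first by rewrite inE zc orbT.
  split=> //; apply: (le_trans z2); rewrite leUx leUr andbT.
  by rewrite label_lt.
exists x; rewrite ?mem_head // leUl; split=> //.
(* From [x] on, no label is below [i], so the rank of the meet with [M i] no longer grows. *)
suff <- : M i `&` x = M i `&` last v c by rewrite leIr.
apply: rk_eq rk_covers _ _ _ _.
  by rewrite leI2 // (le_trans (ltW lxv)) // path_covers_le.
have pxc : path (@covers _ _) x (v :: c) by rewrite /= xv.
have /= := mrk_last i pxc; rewrite /mrk => ->.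
suff -> : count (fun l => (l < i)%N) (label_seq label v c) = 0%N by lia.
apply/eqP; rewrite -leqn0 leqNgt -has_count; apply/hasPn => l /(allP al).
by rewrite -leqNgt; apply: leq_trans.
Qed.

(** * Cuts of an interval and the quasi-EL property *)

Definition cut x y i := x `|` (M i `&` y).

Lemma cutE x y i : x <= y -> cut x y i = (x `|` M i) `&` y.
Proof. by move=> xy; rewrite M_mod. Qed.

(** Left modularity makes the lower and upper bounds from [sorted_label_cut] agree inside the
    interval, so [z] is the cut. *)
Lemma sorted_label_subset x c : path (@covers _ _) x c ->
  sorted <=%O (label_seq label x c) -> forall i, cut x (last x c) i \in x :: c.
Proof.
move=> pc sc i; have [z zc [z1 z2]] := sorted_label_cut i pc sc.
suff -> : cut x (last x c) i = z by [].
have xz := path_covers_ge pc zc.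
have zy : z <= last x c.
  exact: path_covers_mem_le zc.
apply: le_anti;
  rewrite [in X in _ && X]cutE ?(le_trans xz) // lexI z2 zy !andbT.
by rewrite /cut leUx xz.
Qed.

Lemma cut_le x y i : x <= y -> cut x y i <= y.
Proof. by move=> xy; rewrite leUx xy leIr. Qed.

Lemma cut_homo x y i j : (i <= j)%N -> cut x y i <= cut x y j.
Proof. by move=> ij; rewrite leU2 // leI2 // M_homo. Qed.

(** If a label [l] occurs above a cover [u < v] of the chain, the cut of index [l.+1] is not yet
    passed at [v]; lying on the chain, it is above [v], which bounds the label of the cover by
    [l]. *)
Lemma cut_subset_sorted x c : path (@covers _ _) x c ->
  (forall i, cut x (last x c) i \in x :: c) -> sorted <=%O (label_seq label x c).
Proof.
move=> pc Hc.
(* The induction runs over tails of the chain, while the cuts are still taken from [x]; those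
   already passed are below [u]. *)
suff H u : x <= u -> path (@covers _ _) u c ->
    (forall i, cut x (last u c) i <= u \/ cut x (last u c) i \in u :: c) ->
    sorted <=%O (label_seq label u c) by apply: H => // i; right.
elim: c u {pc Hc} => //= v c IH u xu /andP[uv pc] Hc.
have luv : u < v by case/andP: uv.
have Hv i : cut x (last v c) i <= v \/ cut x (last v c) i \in v :: c.
  case: (Hc i) => [h|]; first by left; apply: (le_trans h (ltW luv)).
  by rewrite in_cons => /orP[/eqP->|]; [left; apply: ltW | right].
rewrite (path_sortedE le_trans) IH ?(le_trans xu (ltW luv)) // andbT.
apply/allP => l lc; rewrite -[(_ <= _)%O]/(label u v < l.+1)%N -label_lt //.
have vl : ~~ (cut x (last v c) l.+1 <= v).
  apply/negP => h; have := mrk_last l.+1 pc.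
  have : (mrk l.+1 (last v c) <= mrk l.+1 v)%N.
    apply: rk_le rk_covers _ _ _; rewrite lexI leIl /=.
    by apply: le_trans h; rewrite leUr.
  have : (0 < count (fun k => (k < l.+1)%N) (label_seq label v c))%N.
    by rewrite -has_count; apply/hasP; exists l.
  lia.
have {}vl : v <= cut x (last v c) l.+1.
  by case: (Hv l.+1) => [h|/(path_covers_ge pc)//]; rewrite h in vl.
apply: (le_trans vl); rewrite leUx (le_trans xu (leUl _ _)) /=.
by rewrite (le_trans (leIl _ _)) ?leUr.
Qed.

(** The upper cut bounds the label by [j]. Above the lower cut, [mrk j] is constant, so the label is
    not less than [j]. *)
Lemma label_cut x y j u v : x <= y -> cut x y j <= u -> covers u v ->
  v <= cut x y j.+1 -> label u v = j.
Proof.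
move=> xy ju uv vj; have luv : u < v by case/andP: uv.
have xu : x <= u by apply: le_trans ju; rewrite leUl.
have h1 : (label u v < j.+1)%N.
  rewrite -label_lt //; apply: (le_trans vj);
    rewrite leUx (le_trans xu (leUl _ _)).
  by rewrite (le_trans (leIl _ _)) ?leUr.
have : (mrk j v <= mrk j u)%N.
  apply: rk_le rk_covers _ _ _; rewrite lexI leIl /=; apply: le_trans ju.
  apply: (le_trans _ (leUr _ _)); rewrite leI2 //.
  exact: le_trans vj (cut_le _ xy).
by have := mrk_covers j uv; lia.
Qed.

Lemma label_quasi_EL : quasi_EL_labeling label.
Proof.
move=> x y xy; pose s := mkseq (fun i => cut x y i.+1) r.
have Es : x :: s = mkseq (cut x y) r.+1.
  have c0 : cut x y 0 = x by rewrite /cut M0 meet0x joinx0.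
  by rewrite /s /mkseq /= c0 (iotaDl 1 0 r) -map_comp.
have nths i : (i <= r)%N -> nth x (x :: s) i = cut x y i.
  by move=> ir; rewrite Es nth_mkseq.
have sz : size s = r by rewrite size_mkseq.
have ps : path <=%O x s.
  apply/(pathP x) => i; rewrite sz => ir.
  rewrite nths ?(ltnW ir) // -[nth x s i]/(nth x (x :: s) i.+1) nths //.
  by apply: cut_homo.
have cutr i : (r <= i)%N -> cut x y i = y.
  move=> ri; rewrite /cut.
  have -> : M i = \top by apply: le_anti; rewrite lex1 -Mr M_homo.
  by rewrite meet1x; apply: join_r.
have ls : last x s = y.
  by rewrite (last_nth x) sz nths // cutr.
have [a [pa la ma na]] := strict_subchain ps.
have amem c : {subset x :: a <= x :: c} <-> (forall i, cut x y i \in x :: c).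
  split=> [H i|H z].
    apply: H; rewrite ma; have [ir|ir] := leqP i r.
      by rewrite -nths // mem_nth //= sz ltnS.
    by rewrite cutr ?(ltnW ir) // -ls mem_last.
  by rewrite ma Es => /mapP[i _ ->].
(* Both the weakly ascending condition and the lexicographic one reduce to this equivalence. *)
have amem_sorted c : maximal_chain x y c ->
    {subset x :: a <= x :: c} <-> sorted <=%O (label_seq label x c).
  move=> [pc lc]; rewrite amem -lc; split; first exact: cut_subset_sorted.
  exact: sorted_label_subset.
exists a; split; first by rewrite la.
- by move=> c mc /amem_sorted; apply.
- move=> i /na[j]; rewrite sz => jr [-> ->]; exists j => u v.
  by rewrite nths ?(ltnW jr) // nths // => ju uv vj;
    apply: label_cut xy ju uv vj.
- move=> c c' mc mc' /(amem_sorted _ mc) sc nc'.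
  apply: sorted_seqlexi_lt => //; last by apply/negP => /(amem_sorted _ mc').
  by case: mc mc' => pc lc [pc' lc']; apply: label_seq_perm; rewrite // lc.
Qed.

Lemma count_label c l : maximal_chain \bot \top c ->
  count_mem l (label_seq label \bot c) = (rk (M l.+1) - rk (M l))%N.
Proof.
case=> pc lc; have := mrk_step_last l pc.
by rewrite lc /mrk_step /mrk !meetx0 !meetx1 subnn add0n => ->.
Qed.

Lemma label_counts c : (forall i, (i < r)%N -> M i < M i.+1) ->
  maximal_chain \bot \top c ->
  num_distinct (label_seq label \bot c) = r /\
  num_repeated (label_seq label \bot c) =
    count (fun i => 2 <= rk (M i.+1) - rk (M i))%N (iota 0 r).
Proof.
move=> Mlt mc; set w := label_seq label \bot c.
have Mtop i : (r <= i)%N -> M i = \top.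
  by move=> ri; apply: le_anti; rewrite lex1 -Mr M_homo.
have pw : perm_eq (undup w) (iota 0 r).
  apply: uniq_perm; rewrite ?undup_uniq ?iota_uniq // => l.
  rewrite mem_undup mem_iota add0n /= -has_pred1 has_count count_label //.
  have [lr|rl] := ltnP l r; first by rewrite subn_gt0;
    apply: rk_lt rk_covers _ _ (Mlt _ lr).
  by rewrite !Mtop ?(leq_trans rl) // subnn.
split; first by rewrite /num_distinct (perm_size pw) size_iota.
rewrite /num_repeated size_filter (permP pw); apply: eq_count => l /=.
by rewrite count_label.
Qed.

(** * Truncated label counts and shedding of open intervals *)

Definition width x t : nat := (\sum_(i < r) minn 2 (mrk_step i t - mrk_step i x))%N.

Lemma mrk_step_homo i x y : x <= y -> (mrk_step i x <= mrk_step i y)%N.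
Proof.
case/exists_maximal_chain => c /andP[pc /eqP <-].
by rewrite (mrk_step_last _ pc) leq_addr.
Qed.

Lemma mrk_step_rk i x y : x <= y ->
  (mrk_step i y - mrk_step i x <= rk y - rk x)%N.
Proof.
case/exists_maximal_chain => c /andP[pc /eqP <-].
rewrite (mrk_step_last _ pc) (rk_last rk_covers pc) !addKn.
by rewrite (leq_trans (count_size _ _)) // size_pairmap.
Qed.

Lemma width_triangle x y z : x <= y -> y <= z ->
  (width x z <= width x y + width y z)%N.
Proof.
move=> xy yz; rewrite /width -big_split /=; apply: leq_sum => i _.
have := mrk_step_homo i xy; have := mrk_step_homo i yz; lia.
Qed.

(** Only labels [i] occur between [z] and this cut: the meets with [M k] agree for [k <= i], the
    joins for [k > i]. *)
Lemma mrk_step_cut z t i j : z <= t -> M i `&` t <= z -> j != i ->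
  mrk_step j (cut z t i.+1) = mrk_step j z.
Proof.
move=> zt iz ji; set u := cut z t i.+1.
have zu : z <= u by rewrite leUl.
have ut : u <= t by apply: cut_le.
rewrite /mrk_step; move: ji; rewrite neq_ltn => /orP[ji|ij].
  have E k : (k <= i)%N -> mrk k u = mrk k z.
    move=> ki; rewrite /mrk; congr rk; apply: le_anti.
    rewrite [X in _ && X]leI2 // andbT lexI leIl /=; apply: le_trans iz.
    by rewrite leI2 // M_homo.
  by rewrite !E // ltnW.
have E k : (i < k)%N -> (mrk k u + rk z = mrk k z + rk u)%N.
  move=> ik; have := mrk_modular k u; have := mrk_modular k z.
  suff -> : M k `|` u = M k `|` z by lia.
  apply: le_anti; rewrite [X in _ && X]leU2 // andbT leUx leUl /=.
  rewrite leUx leUr /= (le_trans (leIl _ _)) // (le_trans _ (leUl _ _)) //.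
  exact: M_homo.
by have := E j ij; have := E j.+1 (leqW ij); lia.
Qed.

Lemma sum_eq_leq1 n i : (\sum_(j < n) (j == i :> nat) <= 1)%N.
Proof.
suff -> : (\sum_(j < n) (j == i :> nat) = (i < n))%N by case: (_ < _)%N.
by elim: n => [|n IH]; rewrite ?big_ord0 // big_ord_recr /= IH; lia.
Qed.

(** Skipping from [z] to the cut loses only labels [i]. At least one label [i] already occurs
    between [x] and [z], so the truncated count drops by at most one. *)
Lemma width_cut x z t i : x <= z -> z <= t -> M i `&` t <= x ->
  ~~ (M i.+1 `&` z <= x) ->
  (width x t <= width x z + width (cut z t i.+1) t + 1)%N.
Proof.
move=> xz zt ix zx.
apply: leq_trans (_ : (\sum_(j < r) (minn 2 (mrk_step j z - mrk_step j x) +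
   minn 2 (mrk_step j t - mrk_step j (cut z t i.+1)) + (j == i :> nat)) <= _)%N);
  last by rewrite !big_split /= leq_add2l sum_eq_leq1.
apply: leq_sum => j _.
have h1 := mrk_step_homo j xz.
have h2 : (mrk_step j z <= mrk_step j (cut z t i.+1))%N by rewrite mrk_step_homo ?leUl.
have h3 : (mrk_step j (cut z t i.+1) <= mrk_step j t)%N by rewrite mrk_step_homo ?cut_le.
have [Ej|ji] := eqVneq (j : nat) i; last first.
  have iz : M i `&` t <= z by apply: le_trans ix xz.
  have := mrk_step_cut zt iz ji; lia.
suff : (mrk_step j x < mrk_step j z)%N by lia.
rewrite Ej /mrk_step.
have E : mrk i z = mrk i x.
  rewrite /mrk; congr rk; apply: le_anti; rewrite [X in _ && X]leI2 // andbT.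
  by rewrite lexI leIl (le_trans _ ix) ?leI2.
have : (mrk i.+1 x < mrk i.+1 z)%N.
  apply: rk_lt rk_covers _ _ _; rewrite lt_def leI2 // andbT.
  by apply: contra zx => /eqP ->; rewrite leIr.
by have := mrk_homo (leqnSn i) (lexx x); lia.
Qed.

Lemma width_block x t i : x <= t -> M i `&` t <= x -> cut x t i.+1 = t ->
  (width x t <= minn 2 (rk t - rk x))%N.
Proof.
move=> xt ix Et; set K := minn 2 _.
apply: leq_trans (_ : (\sum_(j < r) (j == i :> nat) * K <= _)%N); last first.
  by rewrite -big_distrl /= -[leqRHS]mul1n leq_mul2r sum_eq_leq1 orbT.
apply: leq_sum => j _; have [Ej|ji] := eqVneq (j : nat) i.
  by rewrite mul1n; have := mrk_step_rk j xt; lia.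
by have := mrk_step_cut xt ix ji; rewrite Et => ->; rewrite subnn.
Qed.

Lemma width_refl x : width x x = 0%N.
Proof. by rewrite /width big1 // => i _; rewrite subnn. Qed.

Definition open_interval x t : {set L} := [set z | x < z < t].

(** What remains of the open interval after the first round of shedding. *)
Definition upper_part i x t : {set L} :=
  [set z in open_interval x t | ~~ (M i.+1 `&` z <= x)].

(** By left modularity such a [v] is the join of [x] with its meet with [M i.+1]; if that meet were
    below [x], [v] would collapse to [x]. *)
Lemma below_cut x t v i : x < v -> v <= cut x t i.+1 -> ~~ (M i.+1 `&` v <= x).
Proof.
move=> xv vc; apply/negP => h.
have : (x `|` M i.+1) `&` v = x by rewrite M_mod ?(ltW xv) // join_l.
suff -> : (x `|` M i.+1) `&` v = v by move=> E; rewrite E ltxx in xv.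
apply: meet_r; apply: (le_trans vc); rewrite leUx leUl /=.
by rewrite (le_trans (leIl _ _)) ?leUr.
Qed.

Lemma joined_lt (A B : {set L}) : (forall a b, a \in A -> b \in B -> a < b) ->
  joined A B.
Proof.
move=> H; split; last by move=> a b aA bB; apply: lt_comparable; apply: H.
by rewrite -setI_eq0; apply/eqP/setP => z; rewrite !inE;
  apply/negP => /andP[zA /(H _ _ zA)]; rewrite ltxx.
Qed.

(** The bottom [u] is a cone point, which makes up for the predecessor in the bound for the open
    interval. *)
Lemma chain_vd_half_open u t : u <= t ->
  (u < t -> chain_vd (width u t).-1 (open_interval u t)) ->
  chain_vd (width u t) [set w | u <= w < t].
Proof.
rewrite le_eqVlt => /orP[/eqP->|ut] H; first by rewrite width_refl;
  apply: chain_vd0.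
have -> : [set w | u <= w < t] = u |: open_interval u t.
  apply/setP => w; rewrite !inE le_eqVlt (eq_sym u).
  by case: eqVneq => [->|] //=; rewrite ut.
apply: chain_vd_leq (leqSpred _) _; apply: chain_vd_cone; last exact: H.
  by rewrite !inE ltxx.
by move=> w; rewrite !inE => /andP[uw _]; rewrite comparable_sym lt_comparable.
Qed.

(** The two claims need a joint induction: links in the open interval have an upper part as a
    factor, and shedding the upper part leads back to open intervals. *)
Lemma open_interval_chain_vd x t : x < t ->
  chain_vd (width x t).-1 (open_interval x t) /\
  (forall i, M i `&` t <= x -> ~~ (M i.+1 `&` t <= x) ->
     chain_vd (width x t).-1 (upper_part i x t)).
Proof.
move En : (rk t - rk x)%N => n; elim/ltn_ind: n x t En => n IH x t En xt.
have IHb z : x < z -> z < t -> (rk z - rk x < n)%N.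
  by move=> /(rk_lt rk_covers) h1 /(rk_lt rk_covers) h2; lia.
have IHa z : x < z -> z < t -> (rk t - rk z < n)%N.
  by move=> /(rk_lt rk_covers) h1 /(rk_lt rk_covers) h2; lia.
have B i : M i `&` t <= x -> ~~ (M i.+1 `&` t <= x) ->
     chain_vd (width x t).-1 (upper_part i x t).
  move=> ix nix; set mu := cut x t i.+1.
  have xmu : x < mu.
    rewrite lt_def leUl andbT; apply: contra nix => /eqP E.
    by rewrite -[leRHS]E leUr.
  have mut : mu <= t by apply: cut_le (ltW xt).
  have up w : mu <= w -> ~~ (M i.+1 `&` w <= x).
    move=> muw; apply: contra nix => h; apply: le_trans h.
    by rewrite lexI leIl; apply: le_trans muw; rewrite leUr.
  move: (mut); rewrite le_eqVlt => /orP[/eqP Emu|lmut].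
    (* Here only label [i] occurs, the width is at most 2, and the claim is at most nonemptiness. *)
    have := width_block (ltW xt) ix Emu.
    case Ew : (width x t) => [|[|k]] /= wb; try exact: chain_vd0.
    have -> : k = 0%N by lia.
    have [v xv vt] := exists_cover xt.
    apply: chain_vd1; apply/set0Pn; exists v; rewrite !inE.
    have lxv : x < v by case/andP: xv.
    rewrite lxv (@below_cut x t v i) // -/mu ?Emu // andbT /= lt_def vt andbT.
    by apply: contraTneq wb => ->; have := rk_covers xv; lia.
  case Ek : (width x t).-1 => [|k]; first exact: chain_vd0.
  apply: (@chain_vd_topdown _ _ _ _ (open_interval x mu :|: [set w | mu <= w < t])).
  - apply/subsetP => w; rewrite !inE => /orP[/andP[xw wmu]|/andP[muw wt]].
      by rewrite xw (lt_trans wmu lmut) (@below_cut x t w i) // ltW.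
    by rewrite (lt_le_trans xmu muw) wt up.
  - apply: (@chain_vd_leq _ _ _ ((width x mu).-1 + width mu t)).
      by have := width_triangle (ltW xmu) mut; lia.
    apply: chain_vd_join.
    + by apply: joined_lt => a b; rewrite !inE => /andP[_ am] /andP[mb _];
      apply: lt_le_trans am mb.
    + exact: (IH _ (IHb _ xmu lmut) _ _ erefl xmu).1.
    + apply: chain_vd_half_open => // _.
      exact: (IH _ (IHa _ xmu lmut) _ _ erefl lmut).1.
  - move=> z; rewrite !inE => /andP[/andP[xz zt] zx].
    rewrite xz zt andbT /= negb_or => /andP[nzmu nmuz].
    (* This is the join of [z] and [mu], so the remaining elements above [z] are those from [u] up
       to, but excluding, [t]. *)
    set u := cut z t i.+1.
    have zu : z <= u by rewrite leUl.
    have ut : u <= t by apply: cut_le (ltW zt).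
    have muu : mu <= u by rewrite leU2 // ltW.
    have nz : ~~ (z <= mu).
      rewrite le_eqVlt negb_or nzmu andbT.
      by apply: contraNneq nmuz => ->.
    have -> : [set w in upper_part i x t | w < z] = upper_part i x z.
      apply/setP => w; rewrite !inE; case: (boolP (w < z)) => [wz|_].
        by rewrite (lt_trans wz zt) !andbT.
      by rewrite !andbF.
    have -> : [set w in open_interval x mu :|: [set w0 | mu <= w0 < t] | z < w]
        = [set w | u <= w < t].
      apply/setP => w; rewrite !inE; apply/andP/andP => [[]|[uw wt]].
        case/orP=> [/andP[_ wmu] zw|/andP[muw wt] zw].
          by rewrite (ltW (lt_trans zw wmu)) in nz.
        split=> //; rewrite leUx (ltW zw) (le_trans _ muw) //.
        by rewrite leUr.
      split; first by rewrite wt (le_trans muu uw) orbT.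
      rewrite lt_def (le_trans zu uw) andbT; apply: contraNneq nmuz => <-.
      exact: le_trans muu uw.
    (* The loss of one in [width_cut] is compensated by the vertex [z] itself. *)
    apply: (@chain_vd_leq _ _ _ ((width x z).-1 + width u t)).
      move: Ek (width_cut (ltW xz) (ltW zt) ix zx); rewrite -/u.
      by move: (width x t) (width x z) (width u t) => f f1 f2; clear; lia.
    apply: chain_vd_join.
    + apply: joined_lt => a b; rewrite !inE => /andP[/andP[_ az] _] /andP[ub _].
      exact: lt_le_trans az (le_trans zu ub).
    + apply: (IH _ (IHb _ xz zt) _ _ erefl xz).2 zx.
      by apply: le_trans ix; rewrite leI2 // ltW.
    + apply: chain_vd_half_open => // lut.
      exact: (IH _ (IHa _ (lt_le_trans xz zu) lut) _ _ erefl lut).1.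
split=> //.
have [i ix nix] : exists2 i, M i `&` t <= x & ~~ (M i.+1 `&` t <= x).
  have ex : exists i, ~~ (M i `&` t <= x) by exists r;
    rewrite Mr meet1x (lt_geF xt).
  case: (ex_minnP ex) => -[|i] Hi imin; first by rewrite M0 meet0x le0x in Hi.
  by exists i => //; apply/negPn/negP => /imin; rewrite ltnn.
case Ek : (width x t).-1 => [|k]; first exact: chain_vd0.
apply: (@chain_vd_topdown _ _ _ _ (upper_part i x t)).
- by apply/subsetP => w; rewrite inE => /andP[].
- by rewrite -Ek; apply: B.
- move=> z; rewrite !inE => /andP[xz zt]; rewrite xz zt negbK => zx.
  have -> : [set w in open_interval x t | w < z] = open_interval x z.
    apply/setP => w; rewrite !inE; case: (boolP (w < z)) => [wz|];
      last by rewrite !andbF.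
    by rewrite (lt_trans wz zt) !andbT.
  (* Since [z] is shed in the first round, testing against [x] or against [z] is the same, and the
     rest above [z] is again an upper part. *)
  have Hz w : (M i.+1 `&` w <= x) = (M i.+1 `&` w <= z).
    apply/idP/idP => [h|h]; first exact: le_trans h (ltW xz).
    by apply: le_trans zx; rewrite lexI leIl.
  have -> : [set w in upper_part i x t | z < w] = upper_part i z t.
    apply/setP => w; rewrite !inE Hz; case: (boolP (z < w)) => [zw|];
      last by rewrite !andbF.
    by rewrite (lt_trans xz zw) !andbT.
  apply: (@chain_vd_leq _ _ _ ((width x z).-1 + (width z t).-1)).
    by have := width_triangle (ltW xz) (ltW zt); lia.
  apply: chain_vd_join.
  + apply: joined_lt => a b; rewrite !inE => /andP[_ az] /andP[/andP[zb _] _].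
    exact: lt_trans az zb.
  + exact: (IH _ (IHb _ xz zt) _ _ erefl xz).1.
  + apply: (IH _ (IHa _ xz zt) _ _ erefl zt).2; last by rewrite -Hz.
    exact: le_trans ix (ltW xz).
Qed.

(** Each count [n] is positive, so its truncation at 2 is one, plus one more when [n] is at least
    2. *)
Lemma width_bot_top : (forall i, (i < r)%N -> M i < M i.+1) ->
  width \bot \top =
    (r + count (fun i => 2 <= rk (M i.+1) - rk (M i))%N (iota 0 r))%N.
Proof.
move=> Mlt; rewrite -sum1_count big_mkcond -[in iota 0 r](subn0 r) big_mkord /=.
have -> : (r + \sum_(i < r) (if (2 <= rk (M i.+1) - rk (M i))%N then 1 else 0) =
    \sum_(i < r) (1 + if (2 <= rk (M i.+1) - rk (M i))%N then 1 else 0))%N.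
  by rewrite big_split /= sum1_card card_ord.
apply: eq_bigr => i _; rewrite /mrk_step /mrk !meetx0 !meetx1 subnn subn0.
have := rk_lt rk_covers (Mlt i (ltn_ord i)); case: ifP; lia.
Qed.

End ModularChain.

(** * Translation to nontrivial intervals and skeleta of the order complex *)

Lemma not_covers_rk (d : Order.disp_t) (L : finTBLatticeType d) (rk : L -> nat) :
  (forall x y : L, covers x y -> rk y = (rk x).+1) ->
  forall x y : L, x < y -> ~~ covers x y = (2 <= rk y - rk x)%N.
Proof.
move=> rk_covers x y xy; have [/rk_covers ->|nxy] := boolP (covers x y);
  first lia.
have [v xv vy] := exists_cover xy.
have lvy : v < y by rewrite lt_def vy andbT; apply: contraNneq nxy => ->.
by have := rk_lt rk_covers lvy; have := rk_covers _ _ xv; lia.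
Qed.

Lemma skeleton_order_complex (d : Order.disp_t) (L : finTBLatticeType d) k :
  skeleton (k%:Z - 1)%R (order_complex L) =
  chain_complex k (open_interval (\bot : L) \top).
Proof.
apply/setP => A; rewrite !inE -/(is_chain A).
have -> : (#|A|%:Z - 1 <= k%:Z - 1)%R = (#|A| <= k)%N by lia.
rewrite !andbA; congr (_ && _ && _).
apply/andP/subsetP => [[nb nt] z zA|H].
  by rewrite inE lt0x ltx1; apply/andP; split;
    [apply: contraNneq nb|apply: contraNneq nt] => <-.
by split; apply/negP => /H; rewrite inE ltxx ?andbF.
Qed.

Theorem theorem4p7 (d : Order.disp_t) (L : finTBLatticeType d)
  (hgraded : graded L)
  (r s : nat) (m : 'I_r.+1 -> L)
  (hbot : m ord0 = Order.bottom) (htop : m ord_max = Order.top)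
  (hchain : forall i j : 'I_r.+1, (i < j)%N -> (m i < m j)%O)
  (hmod : forall i : 'I_r.+1, left_modular (m i))
  (hs : #|[set i : 'I_r |
            ~~ covers (m (widen_ord (leqnSn r) i)) (m (lift ord0 i))]| = s) :
  (exists (d' : Order.disp_t) (Lam : orderType d') (lam : L -> L -> Lam),
      quasi_EL_labeling lam /\
      forall c : seq L, maximal_chain Order.bottom Order.top c ->
        num_distinct (label_seq lam Order.bottom c) = r /\
        num_repeated (label_seq lam Order.bottom c) = s)
  /\ vertex_decomposable
       (skeleton ((r + s)%N%:Z - 2)%R (order_complex L)).
Proof.
have [rk rkc] := graded_rank hgraded.
(* Truncating the index at [r] extends the chain to all natural numbers, constantly top from [r]
   on. *)
pose M i := m (inord (minn i r)).
have inordK' i : (inord (minn i r) : 'I_r.+1) = minn i r :> nat.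
  by rewrite inordK // ltnS geq_minr.
have M0 : M 0 = \bot.
  by rewrite /M -hbot; congr m; apply: val_inj; rewrite /= inordK' min0n.
have Mr : M r = \top.
  by rewrite /M -htop; congr m; apply: val_inj; rewrite /= inordK' minnn.
have M_homo : {homo M : i j / (i <= j)%N >-> i <= j}.
  move=> i j ij; have [E|ne] := eqVneq (minn i r) (minn j r).
    by rewrite /M E.
  by apply/ltW/hchain; rewrite !inordK'; lia.
have Mlt i : (i < r)%N -> M i < M i.+1.
  by move=> ir; apply: hchain; rewrite !inordK'; lia.
have Es : count (fun i => 2 <= rk (M i.+1) - rk (M i))%N (iota 0 r) = s.
  rewrite -hs -sum1_count -[in iota 0 r](subn0 r) big_mkord -sum1_card.
  apply: eq_bigl => i; rewrite inE -(not_covers_rk rkc) ?Mlt //.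
  congr (~~ covers _ _); rewrite /M; congr m; apply: val_inj;
    rewrite /= inordK' ?/bump; have := ltn_ord i; lia.
split.
  exists _, nat, (label Mr M_homo); split;
    first exact: (label_quasi_EL rkc M0 Mr M_homo (fun i => hmod _)).
  move=> c mc; rewrite -Es.
  exact: (label_counts rkc M0 Mr M_homo (fun i => hmod _) Mlt mc).
(* For [r = 0] the lattice has one element and the [(-2)]-skeleton is void; otherwise [r + s] has a
   true predecessor. *)
have [r0|r_gt0] := posnP r.
  apply: VD_simplex; left; apply/setP => A; rewrite !inE.
  have -> : s = 0%N by rewrite -Es r0.
  rewrite r0; apply/negbTE/negP => /andP[_]; lia.
have -> : ((r + s)%N%:Z - 2)%R = ((r + s).-1%:Z - 1)%R by lia.
rewrite skeleton_order_complex; apply: chain_vd_vertex_decomposable.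
have lt01 : (\bot : L) < \top by rewrite -M0 -Mr /M; apply: hchain;
  rewrite !inordK'; lia.
have := (open_interval_chain_vd rkc M0 Mr M_homo (fun i => hmod _) lt01).1.
by rewrite width_bot_top // Es.
Qed.
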